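(* Let $F$ be the field of meromorphic functions on a complex domain $D\subseteq\mathbb{C}$, let $n,s\ge1$ and $\mathcal{M}=\begin{pmatrix}\mathcal{A}&\mathcal{B}\\\mathcal{C}&\mathcal{D}\end{pmatrix}\in F^{(n+s)\times(n+s)}$ with $\mathcal{A}\in F^{n\times n}$, $\mathcal{D}\in F^{s\times s}$. Let $\mathcal{X},\mathcal{Y}\in F^{n\times n}$ be regular (invertible over $F$), let $f\in F$, and let $\mathrm{a}(x)\in F[x]\setminus\{0\}$ satisfy $\mathrm{a}(f\mathbf{I}_n-\mathcal{X}\mathcal{A}\mathcal{Y})\equiv\mathbf{0}$. Set $$\mathcal{P}=\mathcal{Y}\,\mathrm{p}(f,f\mathbf{I}_n-\mathcal{X}\mathcal{A}\mathcal{Y};\mathrm{a})\,\mathcal{X},\qquad \mathcal{S}=\mathrm{a}(f)\,\mathcal{D}-\mathcal{C}\mathcal{P}\mathcal{B}\in F^{s\times s}.$$ If $(\lambda_0,\mathbf{w}_0)$ is a latent pair of $\mathcal{S}$ such that $\lambda_0$ is not a root of $\mathrm{a}(f)$, then $$\left(\lambda_0,\begin{pmatrix}-\mathcal{P}(\lambda_0)\mathcal{B}(\lambda_0)\\ \mathrm{a}(f)(\lambda_0)\,\mathbf{I}_s\end{pmatrix}\mathbf{w}_0\right)$$ is a latent pair of $\mathcal{M}$.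
   Context: For a polynomial $\mathrm{a}(x)=\sum_{k=0}^{d}a_kx^k\in F[x]$, $f\in F$ and $\mathcal{Z}\in F^{n\times n}$: $\mathrm{p}(f,\mathcal{Z};\mathrm{a})=\sum_{k=1}^{d}a_k\sum_{i=1}^{k}f^{\,i-1}\mathcal{Z}^{k-i}$. Let $P\subset D$ be the set of points that are poles of $f$, of an entry of $\mathcal{M}$, $\mathcal{X}$ or $\mathcal{Y}$, or of a coefficient of $\mathrm{a}(x)$, and let $D_P=D\setminus P$. A latent pair of a square matrix $\mathcal{Z}\in\{\mathcal{M},\mathcal{S}\}$ of size $r$ is a pair $(\lambda,\mathbf{u})$ with $\lambda\in D_P$, $\mathbf{0}\ne\mathbf{u}\in\mathbb{C}^r$ and $\mathcal{Z}(\lambda)\mathbf{u}=\mathbf{0}$. A root of $\mathrm{a}(f)$ is a point $\lambda\in D_P$ at which the function $\mathrm{a}(f)\in F$ vanishes. *)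

(* Defs.v *)
From HB Require Import structures.
From mathcomp Require Import all_boot all_order all_algebra.
From mathcomp Require Import complex.
From mathcomp Require Import all_classical all_reals all_analysis.

Set Implicit Arguments.
Unset Strict Implicit.
Unset Printing Implicit Defensive.

Import Order.TTheory GRing.Theory Num.Theory.
Import numFieldNormedType.Exports.

Local Open Scope classical_set_scope.
Local Open Scope ring_scope.

(* [R[i]^o] is the complex plane seen as a normed space over itself, so that
   [derivable g z 1] is complex differentiability at [z]. *)
Notation cplane R := (R[i]^o).

Record domain (R : realType) := Domain {
  dom_set : set (cplane R);
  dom_open : open dom_set;
  dom_connected : connected dom_set;
  dom_nonempty : dom_set !=set0 }.

Section MeromorphicAt.
Variable R : realType.
Implicit Types (f g : cplane R -> cplane R) (z : cplane R).

Definition holomorphic_at g z := \forall w \near z, derivable g w 1.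

Definition removable_at f z :=
  exists2 g, holomorphic_at g z & \forall w \near z^', f w = g w.

Definition meromorphic_at f z :=
  exists N : nat, exists2 g, holomorphic_at g z &
    \forall w \near z^', f w = g w / (w - z) ^+ N.

Lemma holomorphic_cst (c : cplane R) z : holomorphic_at (fun=> c) z.
Proof.
by rewrite /holomorphic_at; near=> w; exact: derivable_cst.
Unshelve. all: by end_near. Qed.

Lemma holomorphicB f g z :
  holomorphic_at f z -> holomorphic_at g z ->
  holomorphic_at (fun w => f w - g w) z.
Proof.
rewrite /holomorphic_at => hf hg.
apply: filterS2 hf hg => w df dg.
exact: derivableB df dg.
Qed.

Lemma holomorphicM f g z :
  holomorphic_at f z -> holomorphic_at g z ->
  holomorphic_at (fun w => f w * g w) z.
Proof.
rewrite /holomorphic_at => hf hg.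
apply: filterS2 hf hg => w df dg.
exact: derivableM df dg.
Qed.

Lemma holomorphic_subX (c : cplane R) N z :
  holomorphic_at (fun w => (w - c) ^+ N) z.
Proof.
elim: N => [|N IH]; first exact: holomorphic_cst.
under [X in holomorphic_at X]eq_fun do rewrite exprS.
apply: (holomorphicM _ IH); apply: (holomorphicB _ (holomorphic_cst c z)).
by rewrite /holomorphic_at; near=> w; exact: derivable_id.
Unshelve. all: by end_near. Qed.

Lemma meromorphic_cst (c : cplane R) z : meromorphic_at (fun=> c) z.
Proof.
exists 0%N; exists (fun=> c); first exact: holomorphic_cst.
by near=> w; rewrite expr0 divr1.
Unshelve. all: by end_near. Qed.

Lemma meromorphicB f g z :
  meromorphic_at f z -> meromorphic_at g z -> meromorphic_at (f - g) z.
Proof.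
move=> [N [f0 hf ef]] [K [g0 hg eg]].
exists (N + K)%N.
exists (fun w => f0 w * (w - z) ^+ K - g0 w * (w - z) ^+ N).
  exact: holomorphicB (holomorphicM hf (holomorphic_subX z K z))
                      (holomorphicM hg (holomorphic_subX z N z)).
near=> w.
have wz : w - z != 0 by rewrite subr_eq0; near: w; exact: nbhs_dnbhs_neq.
have -> : (f - g) w = f w - g w by [].
have -> : f w = f0 w / (w - z) ^+ N by near: w.
have -> : g w = g0 w / (w - z) ^+ K by near: w.
rewrite exprD mulrBl; congr (_ - _).
  by rewrite invfM -!mulrA; congr (_ * _); rewrite mulrCA mulfV ?mulr1// expf_neq0.
by rewrite invfM -!mulrA; congr (_ * _); rewrite mulrA mulfV ?mul1r// expf_neq0.
Unshelve. all: by end_near. Qed.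

Lemma meromorphicM f g z :
  meromorphic_at f z -> meromorphic_at g z -> meromorphic_at (f * g) z.
Proof.
move=> [N [f0 hf ef]] [K [g0 hg eg]].
exists (N + K)%N; exists (fun w => f0 w * g0 w); first exact: (holomorphicM hf hg).
near=> w.
have -> : (f * g) w = f w * g w by [].
have -> : f w = f0 w / (w - z) ^+ N by near: w.
have -> : g w = g0 w / (w - z) ^+ K by near: w.
by rewrite exprD invfM mulrACA.
Unshelve. all: by end_near. Qed.

End MeromorphicAt.

Section MeromorphicField.
Variables (R : realType) (D : domain R).

Definition meromorphic_on : {pred cplane R -> cplane R} :=
  [pred f | `[< forall z, dom_set D z -> meromorphic_at f z >]].

Lemma meromorphic_on_subring : subring_closed meromorphic_on.
Proof.
split=> [|f g /asboolP hf /asboolP hg|f g /asboolP hf /asboolP hg]; apply/asboolP => z Dz.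
- exact: (meromorphic_cst 1).
- by apply: meromorphicB; [exact: hf|exact: hg].
- by apply: meromorphicM; [exact: hf|exact: hg].
Qed.

HB.instance Definition _ :=
  GRing.isSubringClosed.Build _ meromorphic_on meromorphic_on_subring.

(* Representatives are total functions on the plane: their values outside the
   domain and at isolated points of it are irrelevant, and [mero D] is the
   quotient identifying functions that agree on a punctured neighbourhood of
   every point of [D]. *)
Record premero := Premero {
  premero_val :> cplane R -> cplane R;
  premeroP : premero_val \in meromorphic_on }.

HB.instance Definition _ := [isSub for premero_val].
HB.instance Definition _ := [Choice of premero by <:].
HB.instance Definition _ := [SubChoice_isSubComNzRing of premero by <:].

Definition locally_null : {pred premero} :=
  [pred f : premero | `[< forall z, dom_set D z -> \forall w \near z^', f w = 0 >]].

Lemma locally_null_idealr : idealr_closed locally_null.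
Proof.
split=> [||h f g /asboolP hf /asboolP hg].
- by apply/asboolP => z _; near=> w.
- apply/asboolP => h1; have [z Dz] := dom_nonempty D.
  have [w /eqP] := filter_ex (h1 _ Dz).
  by rewrite (oner_eq0 (R[i])).
- apply/asboolP => z Dz; apply: filterS2 (hf _ Dz) (hg _ Dz) => w fw gw.
  have -> : (h * f + g) w = h w * f w + g w by [].
  by rewrite fw gw mulr0 addr0.
Unshelve. all: by end_near. Qed.

HB.instance Definition _ :=
  isIdealr.Build _ locally_null locally_null_idealr.

Definition mero := {ideal_quot locally_null}.
HB.instance Definition _ := GRing.ComNzRing.on mero.

(* [mero] is a field by the isolation of zeros and the connectedness of [D];
   since only its ring operations and invertibility are used here, it is given
   the structure of a commutative ring whose units are the elements having an
   inverse. *)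
Definition mero_unit : {pred mero} := [pred f | `[< exists g, g * f = 1 >]].
Definition mero_inv (f : mero) : mero :=
  if pselect (exists g, g * f = 1) is left ex then sval (cid ex) else f.

Lemma mero_mulVf : {in mero_unit, left_inverse 1 mero_inv *%R}.
Proof.
move=> f /asboolP ex; rewrite /mero_inv; case: pselect => // ex'.
exact: svalP (cid ex').
Qed.

Lemma mero_unitP (f g : mero) : g * f = 1 -> f \in mero_unit.
Proof. by move=> gf; apply/asboolP; exists g. Qed.

Lemma mero_inv_out : {in [predC mero_unit], mero_inv =1 id}.
Proof.
by move=> f /asboolP nex; rewrite /mero_inv; case: pselect.
Qed.

HB.instance Definition _ := GRing.ComNzRing_hasMulInverse.Build mero
  mero_mulVf mero_unitP mero_inv_out.

(* A singularity of a meromorphic function is at most a pole, so that the poles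
   are exactly the points at which it has no holomorphic extension. *)
Definition is_pole (f : mero) (z : cplane R) :=
  ~ removable_at (\val (repr f)) z.

(* The value of [f] at a point that is not a pole; a junk value at poles. *)
Definition mero_eval (f : mero) (z : cplane R) : R[i] :=
  lim (\val (repr f) @ z^').

Definition mx_eval (m n : nat) (Z : 'M[mero]_(m, n)) (z : cplane R) :
  'M[R[i]]_(m, n) := map_mx (mero_eval^~ z) Z.

Definition mx_pole (m n : nat) (Z : 'M[mero]_(m, n)) (z : cplane R) :=
  exists i j, is_pole (Z i j) z.

Definition pole_points (r n : nat) (f : mero) (M : 'M[mero]_r)
    (X Y : 'M[mero]_n) (a : {poly mero}) : set (cplane R) :=
  [set z | dom_set D z /\
    (is_pole f z \/ mx_pole M z \/ mx_pole X z \/ mx_pole Y z \/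
     exists k : nat, is_pole a`_k z)].

Definition latent_pair (DP : set (cplane R)) (r : nat) (Z : 'M[mero]_r)
    (lambda : cplane R) (u : 'cV[R[i]]_r) :=
  [/\ DP lambda, u != 0 & mx_eval Z lambda *m u = 0].

Definition is_root_in (DP : set (cplane R)) (g : mero) (lambda : cplane R) :=
  DP lambda /\ mero_eval g lambda = 0.

End MeromorphicField.

Definition p_mx (F : comNzRingType) (n : nat) (f : F) (Z : 'M[F]_n)
    (a : {poly F}) : 'M[F]_n :=
  \sum_(1 <= k < size a)
    a`_k *: \sum_(1 <= i < k.+1) f ^+ i.-1 *: (Z ^+ (k - i) : 'M[F]_n).

(* Main.v *)
Require Import Defs.
From HB Require Import structures.
From mathcomp Require Import all_boot all_order all_algebra.
From mathcomp Require Import complex.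
From mathcomp Require Import all_classical all_reals all_analysis.

Set Implicit Arguments.
Unset Strict Implicit.
Unset Printing Implicit Defensive.

Import Order.TTheory GRing.Theory Num.Theory.
Import numFieldNormedType.Exports.

Local Open Scope classical_set_scope.
Local Open Scope quotient_scope.
Local Open Scope ring_scope.

(** Telescoping gives [(f I - Z) p(f, Z; a) = a(f) I - a(Z)].  For
    [Z = f I - X A Y] annihilated by [a] this reads [X A Y p = a(f) I], and
    conjugating by [X] yields [A P = a(f) I].  Hence
    [M * (- P B; a(f) I) = (0; S)] over the ring of meromorphic functions.
    At a point of [D_P] every entry involved is regular, and evaluation is a
    ring morphism on the regular functions, so the identity specialises to
    complex matrices. *)

(** * Limits of representatives and functions regular at a point *)

Section Regular.
Variables (R : realType) (D : domain R).
Implicit Types (u v : premero D) (f g : mero D) (z c : cplane R).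

Lemma premero_pi_near u v z : dom_set D z ->
  \pi_(mero D) u = \pi_(mero D) v -> \forall w \near z^', u w = v w.
Proof.
move=> Dz /eqP; rewrite -Quotient.idealrBE => /asboolP /(_ z Dz).
by apply: filterS => w /eqP; rewrite subr_eq0 => /eqP.
Qed.

(** The representative picked by [repr] may differ from [u], but the two agree on a punctured
    neighbourhood of [z], so limits along [z^'] do not depend on the choice. *)
Lemma mero_repr_cvg u z c : dom_set D z ->
  \val u @ z^' --> c -> \val (repr (\pi_(mero D) u)) @ z^' --> c.
Proof.
move=> Dz; apply: cvg_trans; apply: near_eq_cvg.
by apply: premero_pi_near => //; rewrite reprK.
Qed.

Lemma mero_eval_cvg f z c : \val (repr f) @ z^' --> c -> mero_eval f z = c.
Proof. by move=> fc; apply: cvg_lim fc; exact: norm_hausdorff. Qed.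

Lemma mero_cvg1 z : dom_set D z -> \val (repr (1 : mero D)) @ z^' --> (1 : cplane R).
Proof.
move=> Dz; have -> : 1 = \pi_(mero D) 1 by rewrite pi_oner.
by apply: mero_repr_cvg => //; exact: cvg_cst.
Qed.

Lemma mero_cvgB f g z c c' : dom_set D z ->
  \val (repr f) @ z^' --> c -> \val (repr g) @ z^' --> c' ->
  \val (repr (f - g)) @ z^' --> c - c'.
Proof.
move=> Dz fc gc; have -> : f - g = \pi_(mero D) (repr f - repr g).
  by rewrite !rmorphB /= !reprK.
apply: (mero_repr_cvg Dz).
have -> : \val (repr f - repr g) = fun w => \val (repr f) w - \val (repr g) w by [].
exact: cvgB fc gc.
Qed.

Lemma mero_cvgM f g z c c' : dom_set D z ->
  \val (repr f) @ z^' --> c -> \val (repr g) @ z^' --> c' ->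
  \val (repr (f * g)) @ z^' --> c * c'.
Proof.
move=> Dz fc gc; have -> : f * g = \pi_(mero D) (repr f * repr g).
  by rewrite !rmorphM /= !reprK.
apply: (mero_repr_cvg Dz).
have -> : \val (repr f * repr g) = fun w => \val (repr f) w * \val (repr g) w by [].
exact: cvgM fc gc.
Qed.

(* The base point is bundled with its membership in [D], so that being a
   subring needs no side condition. *)
Definition regular_at (p : {z | dom_set D z}) : {pred mero D} :=
  [pred f | `[< cvg (\val (repr f) @ (sval p)^') >]].

Lemma regular_atP p f :
  reflect (\val (repr f) @ (sval p)^' --> (mero_eval f (sval p) : cplane R))
          (f \in regular_at p).
Proof. by apply: (iffP (asboolP _)) => [|fc]; last exact: cvgP fc. Qed.

Lemma regular_at_subring p : subring_closed (regular_at p).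
Proof.
have Dp := svalP p.
split=> [|f g /regular_atP fc /regular_atP gc|f g /regular_atP fc /regular_atP gc];
  apply/asboolP; apply: cvgP.
- exact: mero_cvg1.
- exact: mero_cvgB fc gc.
- exact: mero_cvgM fc gc.
Qed.

HB.instance Definition _ p :=
  GRing.isSubringClosed.Build _ (regular_at p) (regular_at_subring p).

(** A holomorphic extension is differentiable, hence continuous, at [z] itself, and its value there
    is the limit. *)
Lemma removable_cvg (h : cplane R -> cplane R) z : removable_at h z -> cvg (h @ z^').
Proof.
move=> [g hg fg]; apply: (@cvgP _ _ (g z)).
have /derivable1_diffP/differentiable_continuous/continuous_withinNx gz := nbhs_singleton hg.
apply: cvg_trans gz.
by apply: near_eq_cvg; apply: filterS fg => w ->.
Qed.

Lemma regular_at_not_pole p f : ~ is_pole f (sval p) -> f \in regular_at p.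
Proof. by move=> /contrapT rf; apply/asboolP; exact: removable_cvg. Qed.

Lemma mxOver_regular_not_pole p m n (Z : 'M[mero D]_(m, n)) :
  ~ mx_pole Z (sval p) -> Z \is a mxOver (regular_at p).
Proof.
move=> nZ; apply/mxOverP => i j; apply: regular_at_not_pole => Zij.
by apply: nZ; exists i, j.
Qed.

(** * Evaluation at a point as a ring morphism on regular functions *)

Section Eval.
Variable p : {z | dom_set D z}.
Let z := sval p.
Let Dz : dom_set D z := svalP p.

Lemma mero_evalB : {in regular_at p &, {morph (@mero_eval R D)^~ z : f g / f - g}}.
Proof.
move=> f g /regular_atP fc /regular_atP gc.
exact: mero_eval_cvg (mero_cvgB Dz fc gc).
Qed.

Lemma mero_evalM : {in regular_at p &, {morph (@mero_eval R D)^~ z : f g / f * g}}.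
Proof.
move=> f g /regular_atP fc /regular_atP gc.
exact: mero_eval_cvg (mero_cvgM Dz fc gc).
Qed.

Lemma mero_eval0 : mero_eval (0 : mero D) z = 0.
Proof. by rewrite -(subrr 1) mero_evalB ?rpred1// subrr. Qed.

Lemma mero_evalN : {in regular_at p, {morph (@mero_eval R D)^~ z : f / - f}}.
Proof. by move=> f fr; rewrite -sub0r mero_evalB ?rpred0// mero_eval0 sub0r. Qed.

Lemma mero_evalD : {in regular_at p &, {morph (@mero_eval R D)^~ z : f g / f + g}}.
Proof.
by move=> f g fr gr; rewrite -{1}[g]opprK mero_evalB ?rpredN// mero_evalN// opprK.
Qed.

Lemma mero_eval_sum (I : finType) (F : I -> mero D) :
  (forall i, F i \in regular_at p) ->
  mero_eval (\sum_i F i) z = \sum_i mero_eval (F i) z.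
Proof.
move=> Fr.
(* Evaluation is additive only on regular functions, so the induction carries the regularity of
   partial sums along with their values. *)
pose K f c := f \in regular_at p /\ mero_eval f z = c.
suff [] : K (\sum_i F i) (\sum_i mero_eval (F i) z) by [].
apply: (big_ind2 K); rewrite /K.
- by rewrite rpred0 mero_eval0.
- move=> f _ g _ [fr <-] [gr <-].
  split; [exact: rpredD fr gr|exact: mero_evalD fr gr].
- by move=> i _.
Qed.

Lemma mx_evalM m n r (Z : 'M[mero D]_(m, n)) (W : 'M[mero D]_(n, r)) :
  Z \is a mxOver (regular_at p) -> W \is a mxOver (regular_at p) ->
  mx_eval (Z *m W) z = mx_eval Z z *m mx_eval W z.
Proof.
move=> /mxOverP Zr /mxOverP Wr; apply/matrixP => i j.
rewrite !mxE mero_eval_sum => [|k]; last by rewrite rpredM.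
by apply: eq_bigr => k _; rewrite mero_evalM// !mxE.
Qed.

Lemma mx_evalN m n (Z : 'M[mero D]_(m, n)) :
  Z \is a mxOver (regular_at p) -> mx_eval (- Z) z = - mx_eval Z z.
Proof. by move=> /mxOverP Zr; apply/matrixP => i j; rewrite !mxE mero_evalN. Qed.

Lemma mx_eval0 m n : mx_eval (0 : 'M[mero D]_(m, n)) z = 0.
Proof. by apply/matrixP => i j; rewrite !mxE mero_eval0. Qed.

Lemma mx_eval_scalar n f : mx_eval (f%:M : 'M[mero D]_n) z = (mero_eval f z)%:M.
Proof.
apply/matrixP => i j; rewrite !mxE.
by case: (i == j); rewrite ?mulr1n// !mulr0n mero_eval0.
Qed.

End Eval.

Lemma mx_eval_col m1 m2 n (Z : 'M[mero D]_(m1, n)) (W : 'M[mero D]_(m2, n)) z :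
  mx_eval (col_mx Z W) z = col_mx (mx_eval Z z) (mx_eval W z).
Proof. exact: map_col_mx. Qed.

End Regular.

(** * Matrix identities over a commutative ring *)

(** Only ring operations enter [p_mx]. With [S] the functions regular at a point, this keeps [calP]
    free of singularities there. *)
Lemma mxOver_p_mx (F : comNzRingType) (S : subringClosed F) n (f : F)
    (Z : 'M[F]_n.+1) (a : {poly F}) :
  f \in S -> Z \is a mxOver S -> a \is a polyOver S -> p_mx f Z a \is a mxOver S.
Proof.
move=> fS ZS /polyOverP aS; rewrite /p_mx.
apply: rpred_sum => k _; apply: mxOverZ => //.
by apply: rpred_sum => i _; apply: mxOverZ; rewrite ?rpredX.
Qed.

(** Coefficient by coefficient, this is the factorisation of [f^k - Z^k] by [f - Z], valid because
    scalar matrices commute with [Z]. *)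
Lemma mul_subr_p_mx (F : comNzRingType) n (f : F) (Z : 'M[F]_n.+1) (a : {poly F}) :
  (f%:M - Z) *m p_mx f Z a = a.[f]%:M - horner_mx Z a.
Proof.
have -> : horner_mx Z a = \sum_(k < size a) a`_k *: Z ^+ k.
  rewrite -[in LHS](coefK a) poly_def rmorph_sum /=; apply: eq_bigr => k _.
  by rewrite linearZ /= rmorphXn /= horner_mx_X.
rewrite horner_coef [in RHS]raddf_sum /= -sumrB /p_mx mulmx_sumr.
rewrite -[RHS](big_mkord xpredT (fun k => (a`_k * f ^+ k)%:M - a`_k *: Z ^+ k)).
case: (size a) => [|d]; first by rewrite !big_geq.
(* The constant coefficient cancels on the right, which matches the sum in [p_mx] starting at 1. *)
rewrite [RHS]big_nat_recl//= !expr0 mulr1 scalemx1 subrr add0r big_add1 /=.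
apply: eq_bigr => k _; rewrite -scalemxAr -scalemx1 -scalerA -scalerBr.
have fX i : (f ^+ i)%:M = f%:M ^+ i :> 'M[F]_n.+1 by exact: rmorphXn.
congr (_ *: _); rewrite scalemx1 fX.
have cfZ : GRing.comm Z f%:M by exact: scalar_mxC.
(* The factorisation is taken for [Z^(k+1) - f^(k+1)], whose terms [Z^(k-i) f^i] have the exponents
   of [p_mx]; two sign changes turn it round. *)
rewrite -[f%:M ^+ _ - _]opprB (subrXX_comm _ cfZ) -mulNr opprB.
congr (_ * _); rewrite big_add1 big_mkord; apply: eq_bigr => i _ /=.
by rewrite -fX subSS -mul_mx_scalar.
Qed.

Lemma block_mx_mul_col_p_mx (F : comUnitRingType) n s (A : 'M[F]_n.+1)
    (B : 'M[F]_(n.+1, s)) (C : 'M[F]_(s, n.+1)) (E : 'M[F]_s)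
    (X Y : 'M[F]_n.+1) (f : F) (a : {poly F}) :
  X \in unitmx -> horner_mx (f%:M - X *m A *m Y) a = 0 ->
  let P := Y *m p_mx f (f%:M - X *m A *m Y) a *m X in
  block_mx A B C E *m col_mx (- (P *m B)) a.[f]%:M =
  col_mx 0 (a.[f] *: E - C *m P *m B).
Proof.
move=> Xu aZ P; have AP : A *m P = a.[f]%:M.
  have := mul_subr_p_mx f (f%:M - X *m A *m Y) a.
  rewrite aZ subr0 subKr => XAYp.
  (* After multiplying by [X] on the left, [X A P = (X A Y p) X = a(f) X], and the scalar matrix
     commutes with [X]. *)
  by apply: (can_inj (mulKmx Xu)); rewrite /P !mulmxA XAYp scalar_mxC.
rewrite mul_block_col !mulmxN (mulmxA A) AP (mulmxA C) !mul_mx_scalar mul_scalar_mx.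
by rewrite addNr addrC.
Qed.

(** * Specialisation at the latent root *)

Theorem corollary3 (R : realType) (D : domain R) (n s : nat)
    (calA : 'M[mero D]_n.+1) (calB : 'M[mero D]_(n.+1, s.+1))
    (calC : 'M[mero D]_(s.+1, n.+1)) (calD : 'M[mero D]_s.+1)
    (calX calY : 'M[mero D]_n.+1) (f : mero D) (a : {poly mero D}) :
  calX \in unitmx -> calY \in unitmx -> a != 0 ->
  horner_mx (f%:M - calX *m calA *m calY) a = 0 ->
  let calM := block_mx calA calB calC calD in
  let calP := calY *m p_mx f (f%:M - calX *m calA *m calY) a *m calX in
  let calS := a.[f] *: calD - calC *m calP *m calB in
  let DP := dom_set D `\` pole_points f calM calX calY a in
  forall (lambda0 : cplane R) (w0 : 'cV[R[i]]_s.+1),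
  latent_pair DP calS lambda0 w0 ->
  ~ is_root_in DP a.[f] lambda0 ->
  latent_pair DP calM lambda0
    (col_mx (- (mx_eval calP lambda0 *m mx_eval calB lambda0))
            ((mero_eval a.[f] lambda0)%:M) *m w0).
Proof.
move=> Xu _ _ aZ calM calP calS DP lambda0 w0 [DPl w0n0 Sw] nroot.
have [Dl npole] := DPl; pose p := exist (dom_set D) lambda0 Dl.
have fr : f \in regular_at p.
  by apply: regular_at_not_pole => h; apply: npole; split; [|left].
have Mr : calM \is a mxOver (regular_at p).
  by apply: mxOver_regular_not_pole => h; apply: npole; split; [|right; left].
have Xr : calX \is a mxOver (regular_at p).
  by apply: mxOver_regular_not_pole => h; apply: npole; split; [|do 2!right; left].
have Yr : calY \is a mxOver (regular_at p).
  by apply: mxOver_regular_not_pole => h; apply: npole; split; [|do 3!right; left].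
have ar : a \is a polyOver (regular_at p).
  apply/polyOverP => k; apply: regular_at_not_pole => h.
  by apply: npole; split; [|do 4!right; exists k].
have Ar : calA \is a mxOver (regular_at p).
  apply/mxOverP => i j.
  by have /mxOverP/(_ (lshift _ i) (lshift _ j)) := Mr; rewrite block_mxEul.
have Br : calB \is a mxOver (regular_at p).
  apply/mxOverP => i j.
  by have /mxOverP/(_ (lshift _ i) (rshift _ j)) := Mr; rewrite block_mxEur.
(* [pole_points] mentions neither [a.[f]] nor [calP]; their regularity is inherited from the
   data. *)
have afr : a.[f] \in regular_at p by rewrite rpred_horner.
have Pr : calP \is a mxOver (regular_at p).
  apply: (mxOverM (mxOverM Yr _) Xr); apply: (mxOver_p_mx fr _ ar).
  exact: rpredB (mxOver_scalar (rpred0 _) fr) (mxOverM (mxOverM Xr Ar) Yr).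
have PBr : calP *m calB \is a mxOver (regular_at p) by exact: mxOverM Pr Br.
(* As [lambda0] lies in [DP], not being a root means exactly a nonzero value. *)
have af0 : mero_eval a.[f] lambda0 != 0.
  by apply/eqP => h; apply: nroot.
(* The numerical block column is the value of a column over [mero D], to which the block identity
   applies. *)
have uE : col_mx (- (mx_eval calP lambda0 *m mx_eval calB lambda0))
    (mero_eval a.[f] lambda0)%:M =
    mx_eval (col_mx (- (calP *m calB)) (a.[f]%:M : 'M[mero D]_s.+1)) lambda0.
  by rewrite mx_eval_col -(mx_evalM Pr Br) -(mx_evalN PBr) -(mx_eval_scalar p).
split=> //.
(* The lower block is a nonzero multiple of [w0]. *)
- apply: contra w0n0 => /eqP; rewrite mul_col_mx mul_scalar_mx.
  rewrite -[0]col_mx0 => /eq_col_mx[_ /eqP].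
  by rewrite scaler_eq0 (negbTE af0).
- have ur : col_mx (- (calP *m calB)) a.[f]%:M \is a mxOver (regular_at p).
    apply/mxOverP => i j; rewrite mxE; case: splitP => k _; move: k j; apply/mxOverP.
      by rewrite rpredN.
    exact: mxOver_scalar (rpred0 _) afr.
  rewrite uE mulmxA -(mx_evalM Mr ur).
  rewrite block_mx_mul_col_p_mx// mx_eval_col mul_col_mx (mx_eval0 p) mul0mx.
  by rewrite -/calP -/calS Sw col_mx0.
Qed.
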